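(* Let $G$ be a graph for which $\gamma_{gr}^{t}(G)=2\,bc(G)$. Then for every graph $H$, $\gamma_{gr}^{t}(G\times H)=\gamma_{gr}^{t}(G)\,\gamma_{gr}^{t}(H)$.
   Context: Graphs are finite, simple and undirected. $N(v)$ denotes the open neighborhood of $v$. A sequence $(v_1,\ldots,v_k)$ of distinct vertices of $G$ is a (legal) open neighborhood sequence if $N(v_i)\setminus\bigcup_{j=1}^{i-1}N(v_j)\neq\emptyset$ for each $i\in\{1,\ldots,k\}$. The Grundy total domination number $\gamma_{gr}^{t}(G)$ is the maximum length of a legal open neighborhood sequence of $G$ (it is $0$ if $G$ has no edges). The direct product $G\times H$ has vertex set $V(G)\times V(H)$, and $(g_1,h_1)$, $(g_2,h_2)$ are adjacent iff $g_1g_2\in E(G)$ and $h_1h_2\in E(H)$. $bc(G)$ denotes the smallest size of a covering of the edges of $G$ with complete bipartite graphs, i.e. the smallest number of (not necessarily induced) complete bipartite subgraphs of $G$ such that every edge of $G$ lies in at least one of them. *)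

(* Defs.v *)
From mathcomp Require Import all_boot.

Set Implicit Arguments.
Unset Strict Implicit.
Unset Printing Implicit Defensive.

Record sgraph := SGraph {
  vertex :> finType;
  adj : rel vertex;
  adj_sym : symmetric adj;
  adj_irrefl : irreflexive adj
}.

Section GraphParameters.

Variable G : sgraph.

Definition open_nbhd (v : G) : {set G} := [set u | adj v u].

Definition legal_seq (k : nat) (s : k.-tuple G) : bool :=
  uniq s &&
  [forall i : 'I_k,
     open_nbhd (tnth s i) :\: \bigcup_(j < k | j < i) open_nbhd (tnth s j)
       != set0].

(* A sequence of distinct vertices has length at most #|G|. *)
Definition grundy_total : nat :=
  \max_(k < #|G|.+1 | [exists s : k.-tuple G, legal_seq s]) k.

(* A complete bipartite subgraph is represented by its pair of sides; it need
   not be induced, so nothing is required of pairs inside one side. *)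
Definition biclique (P : {set G} * {set G}) : bool :=
  [&& P.1 != set0, P.2 != set0, [disjoint P.1 & P.2] &
      [forall a in P.1, forall b in P.2, adj a b]].

Definition biclique_edge (P : {set G} * {set G}) (u v : G) : bool :=
  (u \in P.1) && (v \in P.2) || (u \in P.2) && (v \in P.1).

(* One subgraph is represented by both (A, B) and (B, A); a cover of minimum
   size never contains both. *)
Definition biclique_cover (C : {set {set G} * {set G}}) : bool :=
  [forall P in C, biclique P] &&
  [forall u, forall v, adj u v ==> [exists P in C, biclique_edge P u v]].

Lemma biclique_cover_all : biclique_cover [set P | biclique P].
Proof.
apply/andP; split; first by apply/forall_inP => P; rewrite inE.
apply/forallP => u; apply/forallP => v; apply/implyP => uv.
apply/exists_inP; exists ([set u], [set v]); last first.
  by rewrite /biclique_edge !inE !eqxx.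
rewrite inE /biclique /= -!card_gt0 !cards1 /= disjoints1 inE.
have -> /= : u != v.
  by apply/eqP => euv; move: uv; rewrite euv adj_irrefl.
by apply/forall_inP => a /set1P->; apply/forall_inP => b /set1P->.
Qed.

Lemma biclique_cover_exists :
  exists n, [exists C, biclique_cover C && (#|C| == n)].
Proof.
exists #|[set P : {set G} * {set G} | biclique P]|.
by apply/existsP; exists [set P | biclique P]; rewrite biclique_cover_all eqxx.
Qed.

Definition bc : nat := ex_minn biclique_cover_exists.

End GraphParameters.

Section DirectProduct.

Variables G H : sgraph.

Definition dprod_adj : rel (G * H) :=
  [rel x y | adj x.1 y.1 && adj x.2 y.2].

Lemma dprod_adj_sym : symmetric dprod_adj.
Proof. by move=> x y; rewrite /dprod_adj /= adj_sym [X in _ && X]adj_sym. Qed.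

Lemma dprod_adj_irrefl : irreflexive dprod_adj.
Proof. by move=> x; rewrite /dprod_adj /= adj_irrefl. Qed.

Definition direct_product : sgraph := SGraph dprod_adj_sym dprod_adj_irrefl.

End DirectProduct.

(* Main.v *)
Require Import Defs.
From mathcomp Require Import all_boot.

Set Implicit Arguments.
Unset Strict Implicit.
Unset Printing Implicit Defensive.

(** Pair every vertex v_i of a legal sequence with a witness w_i that is
    adjacent to v_i but to no earlier v_j. The products of the witnessed pairs
    of G and of H, taken in lexicographic order, are witnessed pairs of G x H,
    which gives the lower bound. For the upper bound, fix an oriented biclique
    (A, B) of an optimal cover and keep only the pairs ((g_i, h_i), (g'_i, h'_i))
    of G x H with g_i in A and g'_i in B. As every such g_j is adjacent to every
    such g'_i, the pairs (h_i, h'_i) are witnessed in H, so at most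
    grundy_total H of them remain. Every edge g_i g'_i lies in one of the
    2 bc(G) oriented bicliques. *)

Definition witnessed (G : sgraph) (s : seq (G * G)) : bool :=
  all (fun p => adj p.1 p.2) s && pairwise (fun p q => ~~ adj p.1 q.2) s.

(** A vertex occurring twice would be adjacent to the witness of its later occurrence. This also
    yields distinctness after a sequence in the product is projected to [H]. *)
Lemma witnessed_uniq (G : sgraph) (s : seq (G * G)) :
  witnessed s -> uniq (unzip1 s).
Proof.
case/andP; elim: s => //= p s IHs /andP[_ adj_s] /andP[p_s /(IHs adj_s)->].
rewrite andbT; apply/mapP => -[q q_s p1q1].
by move: (allP p_s q q_s); rewrite p1q1 (allP adj_s).
Qed.

Lemma witnessed_legal (G : sgraph) (s : seq (G * G)) :
  witnessed s -> legal_seq (in_tuple (unzip1 s)).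
Proof.
move=> ws; rewrite /legal_seq witnessed_uniq //=.
case/andP: ws => adj_s pw_s; apply/forallP => i.
have lt_s (j : 'I_(size (unzip1 s))) : j < size s.
  by rewrite -(size_map fst s).
(* The empty sequence has no index [i]; otherwise the head [x] serves as the default value of
   [nth]. *)
case: s adj_s pw_s i lt_s => [|x s']; first by move=> _ _ [].
set s := x :: s' => adj_s /(pairwiseP x) pw_s i lt_s.
have tnthE (j : 'I_(size (unzip1 s))) :
    tnth (in_tuple (unzip1 s)) j = (nth x s j).1.
  by rewrite (tnth_nth x.1) (nth_map x).
apply/set0Pn; exists (nth x s i).2; rewrite in_setD inE tnthE.
rewrite (allP adj_s) ?mem_nth // andbT.
apply/bigcupP => -[j lt_ji]; rewrite inE tnthE; apply/negP.
by apply: pw_s lt_ji; rewrite inE.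
Qed.

Lemma legal_witnessed (G : sgraph) (k : nat) (s : k.-tuple G) :
  legal_seq s -> exists2 t : seq (G * G), witnessed t & size t = k.
Proof.
case/andP => _ /forallP fp_s.
have /fin_all_exists[w wP] (i : 'I_k) : exists y : G, y \in
    open_nbhd (tnth s i) :\: \bigcup_(j < k | j < i) open_nbhd (tnth s j).
  exact/set0Pn.
exists [seq (tnth s i, w i) | i <- enum 'I_k]; last first.
  by rewrite size_map size_enum_ord.
apply/andP; split.
  apply/allP => _ /mapP[i _ ->] /=.
  by have := wP i; rewrite in_setD inE => /andP[].
rewrite pairwise_map.
(* The indices are enumerated increasingly, so only pairs with [i < j] have to be compared. *)
have : pairwise (relpre val ltn) (enum 'I_k).
  rewrite -pairwise_map val_enum_ord -(sorted_pairwise ltn_trans).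
  exact: iota_ltn_sorted.
apply: sub_pairwise => i j /= lt_ij.
have := wP j; rewrite in_setD => /andP[/bigcupP fresh_j _].
by apply/negP => adj_ij; apply: fresh_j; exists i; rewrite ?inE.
Qed.

Lemma witnessed_grundy (G : sgraph) (s : seq (G * G)) :
  witnessed s -> size s <= grundy_total G.
Proof.
move=> ws; have le_sG : size (unzip1 s) < #|G|.+1.
  by rewrite ltnS -(card_uniqP (witnessed_uniq ws)) max_card.
rewrite -(size_map fst s).
apply: (leq_bigmax_cond (F := fun k : 'I_#|G|.+1 => k : nat) (Ordinal le_sG)).
by apply/existsP; exists (in_tuple (unzip1 s)); apply: witnessed_legal.
Qed.

Lemma grundy_witnessed (G : sgraph) :
  exists2 s : seq (G * G), witnessed s & size s = grundy_total G.
Proof.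
(* The lengths of witnessed sequences include 0 and are closed under binary maxima, so the maximum
   is attained. *)
rewrite /grundy_total; elim/big_ind: _ => [|m n|k].
- by exists [::].
- by rewrite /maxn; case: ifP.
- by case/existsP => s /legal_witnessed.
Qed.

Definition pair_prod (G H : sgraph) (p : G * G) (q : H * H) :
    direct_product G H * direct_product G H :=
  ((p.1, q.1), (p.2, q.2)).

Lemma witnessed_allpairs (G H : sgraph) (s : seq (G * G)) (t : seq (H * H)) :
  witnessed s -> witnessed t ->
  witnessed [seq pair_prod p q | p <- s, q <- t].
Proof.
move=> ws /andP[adj_t pw_t]; case/andP: ws => adj_s pw_s.
apply/andP; split.
  apply/allP => _ /allpairsP[[p q] [/= p_s q_t ->]] /=.
  by rewrite /dprod_adj /= (allP adj_s) ?(allP adj_t).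
elim: s adj_s pw_s => //= p s IHs /andP[_ adj_s] /andP[p_s pw_s].
(* Between the block of [p] and later blocks adjacency fails in [G]; inside the block it fails in
   [H]. *)
rewrite pairwise_cat IHs // andbT; apply/andP; split.
  apply/allrelP => _ _ /mapP[q q_t ->] /allpairsP[[p' q'] [/= p'_s q'_t ->]] /=.
  by rewrite /dprod_adj /= negb_and (allP p_s p').
rewrite pairwise_map; apply: sub_pairwise pw_t => q q' /= nadj.
by rewrite /dprod_adj /= negb_and nadj orbT.
Qed.

Lemma grundy_direct_product_ge (G H : sgraph) :
  grundy_total G * grundy_total H <= grundy_total (direct_product G H).
Proof.
have [s ws <-] := grundy_witnessed G; have [t wt <-] := grundy_witnessed H.
by rewrite -(size_allpairs (@pair_prod G H)) witnessed_grundy ?witnessed_allpairs.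
Qed.

(** Every entry is counted at least once on the right; overlaps of the [a i] only enlarge the
    sum. *)
Lemma size_le_sum_count (T : eqType) (I : finType) (D : {set I})
    (a : I -> pred T) (s : seq T) :
  {in s, forall x, exists2 i, i \in D & a i x} ->
  size s <= \sum_(i in D) count (a i) s.
Proof.
elim: s => [|x s IHs] cov //=; rewrite big_split /= -add1n leq_add //.
  have [i iD aix] := cov x (mem_head x s).
  by rewrite (bigD1 i) //= aix.
by apply: IHs => y y_s; apply: cov; rewrite inE y_s orbT.
Qed.

Lemma count_oriented (G H : sgraph) (A B : {set G})
    (s : seq (direct_product G H * direct_product G H)) :
  {in A & B, forall a b, adj a b} -> witnessed s ->
  count (fun p => (p.1.1 \in A) && (p.2.1 \in B)) s <= grundy_total H.
Proof.
move=> adjAB /andP[adj_s pw_s]; set a := (fun p => _).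
rewrite -size_filter -(size_map (fun p => (p.1.2, p.2.2))).
apply: witnessed_grundy; apply/andP; split.
  apply/allP => _ /mapP[p + ->] /=; rewrite mem_filter => /andP[_ p_s].
  by have /andP[] := allP adj_s p p_s.
rewrite pairwise_map; have := pairwise_filter a pw_s.
(* For entries kept by the filter, [p.1.1] and [q.2.1] are adjacent in [G], so non-adjacency in the
   product must come from [H]. *)
apply: (sub_in_pairwise (P := a)); last exact: filter_all.
move=> p q /andP[pA _] /andP[_ qB] /=.
by rewrite /dprod_adj /= adjAB.
Qed.

Lemma bc_cover (G : sgraph) :
  exists2 C : {set {set G} * {set G}}, biclique_cover C & #|C| = bc G.
Proof.
by rewrite /bc; case: ex_minnP => n /existsP[C /andP[covC /eqP]]; exists C.
Qed.

Lemma grundy_direct_product_le (G H : sgraph) :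
  grundy_total (direct_product G H) <= 2 * bc G * grundy_total H.
Proof.
have [C /andP[/forall_inP bicC /forallP covC] <-] := bc_cover G.
have [s ws <-] := grundy_witnessed (direct_product G H).
pose a (P : {set G} * {set G}) (p : direct_product G H * direct_product G H) :=
  biclique_edge P p.1.1 p.2.1.
apply: (@leq_trans (\sum_(P in C) count (a P) s)).
  apply: size_le_sum_count => p p_s; case/andP: ws => adj_s _.
  have /andP[adj_p _] := allP adj_s p p_s.
  by have /forallP/(_ p.2.1)/implyP/(_ adj_p)/exists_inP := covC p.1.1.
(* The bound becomes a constant sum over [C], leaving [2 * grundy_total H] for each biclique. *)
rewrite -mulnA mulnCA -sum_nat_const; apply: leq_sum => -[A B] /bicC.
case/and4P => _ _ _ /forall_inP /= adjAB.
have {}adjAB : {in A & B, forall x y, adj x y}.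
  by move=> x y xA; apply/forall_inP: y; apply: adjAB.
have adjBA : {in B & A, forall x y, adj x y}.
  by move=> x y xB yA; rewrite adj_sym adjAB.
(* One summand for each orientation: [biclique_edge] is the union of the two oriented predicates. *)
rewrite mul2n -addnn.
apply: leq_trans (leq_add (count_oriented adjAB ws) (count_oriented adjBA ws)).
by rewrite -count_predUI leq_addr.
Qed.

Theorem theorem2p7 (G : sgraph) (hG : grundy_total G = 2 * bc G) (H : sgraph) :
  grundy_total (direct_product G H) = grundy_total G * grundy_total H.
Proof.
apply/eqP; rewrite eqn_leq grundy_direct_product_ge andbT hG.
exact: grundy_direct_product_le.
Qed.
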